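(* Let $\Omega\subset\mathbb{R}^2$ be a strictly convex bounded domain with $C^{2,\alpha}$ boundary $\partial\Omega$, $\alpha>1/2$, let $\mu>0$ be a known real number, and let $p>4$. Within the class of real valued symmetric 2-tensor fields $\mathbf{F}=(f_{ij})\in W^{3,p}(\Omega;\mathbb{R}^{2\times 2})$ that are supported in the interior of $\Omega$ and trace-free ($f_{11}+f_{22}=0$ in $\Omega$), the tensor field $\mathbf{F}$ is uniquely determined in $\Omega$ by the data $u|_{\partial\Omega_+}$, where $u$ is the solution of the boundary value problem $$\boldsymbol\theta\cdot\nabla u(x,\boldsymbol\theta)+\mu u(x,\boldsymbol\theta)=\langle \mathbf{F}(x)\boldsymbol\theta,\boldsymbol\theta\rangle,\quad (x,\boldsymbol\theta)\in\Omega\times\mathbf{S}^1,\qquad u|_{\partial\Omega_-}=0.$$ That is, if $\mathbf{F}$ and $\tilde{\mathbf{F}}$ are two tensor fields in this class whose corresponding solutions $u$ and $\tilde u$ satisfy $u|_{\partial\Omega_+}=\tilde u|_{\partial\Omega_+}$, then $\mathbf{F}=\tilde{\mathbf{F}}$ in $\Omega$.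
   Context: $\mathbf{S}^1$ is the unit circle in $\mathbb{R}^2$, $\langle\cdot,\cdot\rangle$ is the Euclidean scalar product, and $\nabla$ is the gradient in the spatial variable $x$. A real symmetric 2-tensor field is a matrix-valued function $\mathbf{F}=\begin{pmatrix} f_{11}& f_{12}\\ f_{12}& f_{22}\end{pmatrix}$ with real valued entries. ''Supported in the interior of $\Omega$'' means that the support of $\mathbf{F}$ (as a field on $\mathbb{R}^2$) is contained in the open set $\Omega$. With $\eta(\zeta)$ the outer unit normal at $\zeta\in\partial\Omega$, set $\partial\Omega_\pm=\{(\zeta,\boldsymbol\theta)\in\partial\Omega\times\mathbf{S}^1:\ \pm\eta(\zeta)\cdot\boldsymbol\theta>0\}$. The boundary value problem has a unique solution $u$ in $\Omega\times\mathbf{S}^1$, and its trace on $\partial\Omega_+$ is the exponential X-ray transform $$u|_{\partial\Omega_+}(x,\boldsymbol\theta)=X_\mu\mathbf{F}(x,\boldsymbol\theta)=\int_{-\tau(x,\boldsymbol\theta)}^0\langle\mathbf{F}(x+t\boldsymbol\theta)\boldsymbol\theta,\boldsymbol\theta\rangle e^{\mu t}\,dt,$$ where $\tau(x,\boldsymbol\theta)$ is the length of the chord of $\Omega$ through $x$ in direction $\boldsymbol\theta$. *)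

(* Defs.v *)
From HB Require Import structures.
From mathcomp Require Import all_boot all_order all_algebra.
From mathcomp Require Import all_classical all_reals all_analysis.

Set Implicit Arguments.
Unset Strict Implicit.
Unset Printing Implicit Defensive.

Import Order.TTheory GRing.Theory Num.Theory.
Import numFieldNormedType.Exports.

Local Open Scope classical_set_scope.
Local Open Scope ring_scope.

(* The library norm of R * R is the max norm: it is used only for topological
   notions; Euclidean quantities are written with [dot]. *)
Section Plane.
Context {R : realType}.
Implicit Types (x v theta : R * R) (Omega : set (R * R)).

Definition dot x v : R := x.1 * v.1 + x.2 * v.2.

Definition perp v : R * R := (- v.2, v.1).

Definition circle : set (R * R) := [set theta | dot theta theta = 1].

Definition boundary Omega : set (R * R) := closure Omega `\` interior Omega.

Definition mulmxp (A : 'M[R]_2) v : R * R :=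
  (A 0 0 * v.1 + A 0 1 * v.2, A 1 0 * v.1 + A 1 1 * v.2).

Definition grad (f : R * R -> R) x : R * R :=
  ('D_((1, 0) : R * R) f x, 'D_((0, 1) : R * R) f x).

Definition domain Omega := [/\ open Omega, Omega !=set0 & connected Omega].

Definition strictly_convex Omega :=
  forall x v (t : R), closure Omega x -> closure Omega v -> x <> v ->
    0 < t < 1 -> interior Omega (t *: x + (1 - t) *: v).

(* Near zeta, in the orthonormal frame (perp n, n) centred at zeta, Omega is
   the region below the graph of gamma; n thus points out of Omega. *)
Definition graph_chart Omega (zeta n : R * R) (r : R) (gamma : R -> R) :=
  [/\ dot n n = 1, 0 < r &
   forall x, dot (x - zeta) (x - zeta) < r ^+ 2 ->
     (Omega x <-> dot (x - zeta) n < gamma (dot (x - zeta) (perp n)))].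

Definition C2_holder_on (I : set R) (alpha : R) (gamma : R -> R) :=
  (forall s, I s -> derivable gamma s 1 /\ derivable (derive1 gamma) s 1) /\
  exists M : R, forall s t, I s -> I t ->
    `|derive1n 2 gamma s - derive1n 2 gamma t| <= M * `|s - t| `^ alpha.

Definition C2_holder_boundary (alpha : R) Omega :=
  forall zeta, boundary Omega zeta ->
    exists (n : R * R) (r : R) (gamma : R -> R),
      graph_chart Omega zeta n r gamma /\
      C2_holder_on [set s | - r < s < r] alpha gamma.

Definition outer_normal Omega (zeta eta : R * R) :=
  exists (n : R * R) (r : R) (gamma : R -> R),
    [/\ graph_chart Omega zeta n r gamma, derivable gamma 0 1 &
     eta = (Num.sqrt (1 + (derive1 gamma 0) ^+ 2))^-1 *:
           (n - derive1 gamma 0 *: perp n)].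

Definition outflow Omega : set ((R * R) * (R * R)) :=
  [set z | [/\ boundary Omega z.1, circle z.2 &
    exists2 eta, outer_normal Omega z.1 eta & 0 < dot eta z.2]].

Definition inflow Omega : set ((R * R) * (R * R)) :=
  [set z | [/\ boundary Omega z.1, circle z.2 &
    exists2 eta, outer_normal Omega z.1 eta & dot eta z.2 < 0]].

(* R * R seen with the product of the Borel sigma-algebras. *)
Definition leb2 :
    {measure set (measurableTypeR R * measurableTypeR R)%type -> \bar R} :=
  (@lebesgue_measure R \x @lebesgue_measure R)%E.

Definition ae_in Omega (P : R * R -> Prop) :=
  {ae leb2, forall x, Omega x -> P x}.

Definition Lp Omega (p : R) (f : R * R -> R) :=
  @measurable_fun _ _ (measurableTypeR R * measurableTypeR R)%type
    (measurableTypeR R) Omega f /\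
  finite_norm leb2 p%:E (f \_ Omega).

Definition partial (a b : nat) (f : R * R -> R) : R * R -> R :=
  iter a (fun g x => 'D_((1, 0) : R * R) g x)
    (iter b (fun g x => 'D_((0, 1) : R * R) g x) f).

Definition smooth (phi : R * R -> R) :=
  forall s : seq bool, forall x,
    differentiable
      (foldr (fun (d : bool) g y =>
                'D_((if d then (1, 0) else (0, 1)) : R * R) g y) phi s) x.

Definition test_function Omega (phi : R * R -> R) :=
  let supp := closure [set x | phi x != 0] in
  [/\ smooth phi, compact supp & supp `<=` Omega].

Definition weak_partial Omega (a b : nat) (f g : R * R -> R) :=
  forall phi, test_function Omega phi ->
    \int[leb2]_(x in Omega) (f x * partial a b phi x) =
    (-1) ^+ (a + b) * \int[leb2]_(x in Omega) (g x * phi x).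

Definition sobolev Omega (k : nat) (p : R) (f : R * R -> R) :=
  Lp Omega p f /\
  forall a b : nat, (a + b <= k)%N ->
    exists2 g, Lp Omega p g & weak_partial Omega a b f g.

(* Support of a class of a.e. equal functions. *)
Definition ess_support (F : R * R -> 'M[R]_2) : set (R * R) :=
  [set x | ~ exists U : set (R * R), open_nbhs x U /\
             ae_in U (fun y => F y = 0)].

Definition tensor_class Omega (p : R) (F : R * R -> 'M[R]_2) :=
  [/\ forall i j, sobolev Omega 3 p (fun x => F x i j),
      ae_in Omega (fun x => (F x)^T = F x),
      ess_support F `<=` Omega &
      ae_in Omega (fun x => F x 0 0 + F x 1 1 = 0)].

(* F is only given up to null sets, hence the equation holds a.e.; its sides
   agree everywhere for the continuous representative of F. *)
Definition transport_solution Omega (mu : R) (F : R * R -> 'M[R]_2)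
    (u : R * R -> R * R -> R) :=
  (forall theta, circle theta ->
    [/\ {within closure Omega, continuous (u^~ theta)},
        forall x, Omega x -> differentiable (u^~ theta) x,
        {within Omega, continuous (grad (u^~ theta))} &
        ae_in Omega (fun x => dot theta (grad (u^~ theta) x) + mu * u x theta
                              = dot (mulmxp (F x) theta) theta)]) /\
  (forall zeta theta, inflow Omega (zeta, theta) -> u zeta theta = 0).

End Plane.

(* Main.v *)
Require Import Defs.
From HB Require Import structures.
From mathcomp Require Import all_boot all_order all_algebra.
From mathcomp Require Import all_classical all_reals all_analysis.
From mathcomp Require Import measurable_realfun.
From mathcomp Require Import ring lra.
Import Order.TTheory GRing.Theory Num.Theory.
Import numFieldNormedType.Exports.
Local Open Scope classical_set_scope.
Local Open Scope ring_scope.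
Set Implicit Arguments.
Unset Strict Implicit.
Unset Printing Implicit Defensive.

(** The proof replaces complex frequencies by real ones: it tests the equation
    against real exponentials and uses injectivity of the Laplace transform.

    Put [w = u - u'] and let [g1], [g2] be the two components of the trace-free
    field [F - F'], so that for [theta] on the circle
      [theta . grad w + mu w =
         g1 (theta1^2 - theta2^2) + 2 g2 theta1 theta2].

    Support. Along a line of direction [theta], [w] is multiplied by [exp (- mu t)]
    as long as the line avoids the supports of [F] and [F']. Equality of the data
    makes [w] vanish at both ends of every chord (chords of a strictly convex
    domain meet the boundary transversally, [exit_transversal]); therefore [w]
    vanishes outside a compact subset of the domain
    ([transport_compact_support]).

    Testing. If [theta . xi = mu], the exponential [e(x) = exp (xi . x)] satisfies
    [(theta . grad w + mu w) e = theta . grad (w e)], whose integral is zero. Hence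
    the integral of [(g1 (theta1^2 - theta2^2) + 2 g2 theta1 theta2) e] is zero
    ([zero_integral_tracefree_weight]).

    Two directions. For a fixed [xi] with [|xi| > mu] there are exactly two unit
    vectors with [theta . xi = mu], and when [|xi|^2 > 2 mu^2] the two resulting
    equations for the transforms of [g1] and [g2] at [xi] are independent
    ([two_directions]). So both transforms vanish for all large [xi].

    Uniqueness. A function supported in a bounded set whose Laplace transform
    vanishes on a translate of the lattice quadrant of pairs of natural numbers is
    zero almost everywhere ([laplace_eq0]): the functions [exp (- n exp (n (t - c)))]
    are limits of combinations of exponentials and converge boundedly to the
    indicator of [t < c]. *)

(** * Functions with zero integral *)

Section ZeroIntegral.
Context d (T : measurableType d) (R : realType).
Variable mu : {measure set T -> \bar R}.
Implicit Types (f g h X : T -> R).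

Definition zero_integral (f : T -> R) :=
  mu.-integrable setT (EFin \o f) /\ (\int[mu]_x (f x)%:E = 0)%E.

Lemma zero_integral0 : zero_integral (fun=> 0).
Proof.
split; first exact: integrable0.
by rewrite integral0.
Qed.

Lemma zero_integralD f g :
  zero_integral f -> zero_integral g -> zero_integral (fun x => f x + g x).
Proof.
move=> [fi f0] [gi g0]; split; first exact: (integrableD _ fi gi).
by under eq_integral do rewrite EFinD; rewrite integralD// f0 g0 adde0.
Qed.

Lemma zero_integralZ k f : zero_integral f -> zero_integral (fun x => k * f x).
Proof.
move=> [fi f0]; split; first exact: (integrableZl _ _ fi).
by under eq_integral do rewrite EFinM; rewrite integralZl// f0 mule0.
Qed.

Lemma zero_integral_sum (F : nat -> T -> R) n :
  (forall k, zero_integral (F k)) ->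
  zero_integral (fun x => \sum_(0 <= k < n) F k x).
Proof.
move=> F0; elim: n => [|n IH].
  by under eq_fun do rewrite big_geq//; exact: zero_integral0.
under eq_fun do rewrite big_nat_recr//=.
exact: zero_integralD.
Qed.

(** Dominated convergence. This closure property is what lets every later
    limit (series, truncation, countable union) stay inside the class. *)
Lemma zero_integral_cvg (F : nat -> T -> R) f g :
  (forall n, zero_integral (F n)) ->
  (forall x, F n x @[n --> \oo] --> f x) ->
  mu.-integrable setT (EFin \o g) ->
  (forall n x, `|F n x| <= g x) ->
  zero_integral f.
Proof.
move=> F0 Ff gi Fg.
have mF n : measurable_fun setT (F n).
  by apply/measurable_EFinP; have [/measurable_int] := F0 n.
have mf : measurable_fun setT f.
  by apply: (measurable_fun_cvg (h := F)) => // x _; exact: Ff.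
have [||||] := @dominated_convergence _ T R mu setT measurableT
    (fun n => EFin \o F n) (EFin \o f) (EFin \o g) _ _ _ gi.
- by move=> n; exact/measurable_EFinP.
- exact/measurable_EFinP.
- by apply: aeW => x _; apply/fine_cvgP; split; [exact: nearW|exact: Ff].
- by apply: aeW => x n _ /=; rewrite lee_fin.
move=> fi _ cv; split=> //.
have /cvg_lim <- // := cv.
by apply: lim_near_cst => //; apply: nearW => n; have [_] := F0 n.
Qed.

Lemma zero_integral_ae f g : measurable_fun setT g ->
  {ae mu, forall x, f x = g x} -> zero_integral f -> zero_integral g.
Proof.
move=> mg fg [fi f0].
have mf := measurable_int _ fi.
have mg' : measurable_fun setT (EFin \o g) by exact/measurable_EFinP.
split; last first.
  rewrite -f0; apply: ae_eq_integral => //.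
  by apply: filterS fg => x /= ->.
apply/integrableP; split => //.
have /integrableP[_] := fi.
congr (_ < _)%E; apply: ae_eq_integral => //; try exact: measurableT_comp.
by apply: filterS fg => x /= ->.
Qed.

(** Cramer's rule inside the class: two independent combinations of [g1] and
    [g2] are enough to recover each of them, with the same weight [e]. *)
Lemma zero_integral_solve2 (D : set T) (g1 g2 e : T -> R) (c s c' s' : R) :
  c * s' - c' * s != 0 ->
  zero_integral ((fun x => (g1 x * c + g2 x * s) * e x) \_ D) ->
  zero_integral ((fun x => (g1 x * c' + g2 x * s') * e x) \_ D) ->
  zero_integral ((fun x => g1 x * e x) \_ D) /\
  zero_integral ((fun x => g2 x * e x) \_ D).
Proof.
set det := c * s' - c' * s => det0 Z Z'; split.
- have := zero_integralD (zero_integralZ (s' / det) Z) (zero_integralZ (- s / det) Z').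
  congr zero_integral; apply/funext => x; rewrite !patchE.
  by case: ifP => _; [rewrite /det in det0 *; field|rewrite !mulr0 addr0].
- have := zero_integralD (zero_integralZ (- c' / det) Z) (zero_integralZ (c / det) Z').
  congr zero_integral; apply/funext => x; rewrite !patchE.
  by case: ifP => _; [rewrite /det in det0 *; field|rewrite !mulr0 addr0].
Qed.

(** Expand the exponential in powers of [X]; the partial sums are dominated by
    [|h| exp (|k| C)] because [X] is bounded wherever [h] lives. *)
Lemma zero_integral_expR h X C k :
  measurable_fun setT X -> (forall x, h x != 0 -> `|X x| <= C) ->
  (forall n, zero_integral (fun x => h x * X x ^+ n)) ->
  zero_integral (fun x => h x * expR (k * X x)).
Proof.
move=> mX XC hX.
pose F n x := \sum_(0 <= i < n) (k ^+ i / i`!%:R) * (h x * X x ^+ i).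
have FE n x : F n x = h x * series (exp_coeff (k * X x)) n.
  rewrite /F /series /= mulr_sumr; apply: eq_bigr => i _.
  by rewrite /exp_coeff /= exprMn; ring.
have hi : mu.-integrable setT (EFin \o h).
  by have [+ _] := hX 0; under eq_fun do rewrite expr0 mulr1.
apply: (@zero_integral_cvg F _ (fun x => `|h x| * expR (`|k| * C))).
- by move=> n; apply: zero_integral_sum => i; exact: zero_integralZ.
- move=> x; under eq_fun do rewrite FE.
  by apply: cvgMr => //; exact: is_cvg_series_exp_coeff.
- under eq_fun do rewrite mulrC.
  exact: (integrableZl _ _ (integrable_norm hi)).
- move=> n x; rewrite FE normrM; have [->|hx] := eqVneq (h x) 0.
    by rewrite normr0 !mul0r.
  rewrite ler_wpM2l//.
  apply: (@le_trans _ _ (series (exp_coeff (`|k| * C)) n)).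
    rewrite /series /=; apply: (le_trans (ler_norm_sum _ _ _)).
    apply: ler_sum => i _; rewrite /exp_coeff /= normrM normrX normrM.
    rewrite [X in _ * X <= _]ger0_norm ?invr_ge0//.
    apply: ler_wpM2r; first by rewrite invr_ge0.
    by apply: lerXn2r; rewrite ?nnegrE ?mulr_ge0 ?ler_wpM2l ?XC// (le_trans _ (XC _ hx)).
  have C0 : 0 <= C by rewrite (le_trans _ (XC _ hx)).
  rewrite /expR; apply: nondecreasing_cvgn_le.
    apply/nondecreasing_series => i _ _.
    by rewrite /exp_coeff /= divr_ge0// exprn_ge0// mulr_ge0.
  exact: is_cvg_series_exp_coeff.
Qed.

End ZeroIntegral.

(** * Uniqueness for the Laplace transform in one variable *)

Section ZeroIntegralIndic.
Context d (T : measurableType d) (R : realType).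
Variable mu : {measure set T -> \bar R}.
Implicit Types (f g h X : T -> R).
Local Notation zero_integral := (@zero_integral d T R mu).

Lemma sum_indic_trivIset (S : Type) (F : nat -> set S) n (y : S) :
  trivIset setT F ->
  \sum_(0 <= i < n) \1_(F i) y = \1_(\bigcup_(i < n) F i) y :> R.
Proof.
move=> tF; elim: n => [|n IH].
  by rewrite big_geq// indicE memNset// => -[].
rewrite big_nat_recr//= IH !indicE.
have [yF|yF] := boolP (y \in F n); last first.
  rewrite addr0; congr (_%:R); congr nat_of_bool.
  apply/idP/idP => /set_mem[i /= ltin Fi]; apply/mem_set; exists i => //=.
    exact: ltnW.
  move: ltin; rewrite ltnS leq_eqVlt => /predU1P[ein|//].
  by rewrite -ein mem_set in yF.
rewrite memNset /= ?add0r ?mem_set//=; first by exists n; rewrite /= ?ltnSn//; exact: set_mem.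
move=> [i /= ltin Fi].
have := tF i n I I (ex_intro _ _ (conj Fi (set_mem yF))).
by move=> /eqP; rewrite ltn_eqF.
Qed.

(** The sets [A] for which [h] integrates to zero over the preimage of [A] form
    a Dynkin system, so a generating pi-system suffices. *)
Lemma zero_integral_dynkin d' (T' : measurableType d') (Y : T -> T')
    (G : set (set T')) h :
  @measurable _ T' = <<s G >> -> setI_closed G ->
  zero_integral h ->
  (forall A, G A -> zero_integral (fun x => h x * \1_A (Y x))) ->
  forall A, measurable A -> zero_integral (fun x => h x * \1_A (Y x)).
Proof.
move=> mG GI h0 hG A; rewrite mG.
apply: (@dynkin_induction _ _ G
  (fun A => zero_integral (fun x => h x * \1_A (Y x)))) => //.
- by under eq_fun do rewrite indicT mulr1.
- move=> S mS hS.
  have -> : (fun x => h x * \1_(~` S) (Y x)) =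
            (fun x => h x + (-1) * (h x * \1_S (Y x))).
    apply/funext => x; rewrite !indicE in_setC.
    by case: (Y x \in S); rewrite /= ?mulr1 ?mulr0 ?addr0 // mulN1r subrr.
  by apply: zero_integralD => //; exact: zero_integralZ.
- move=> F mF tF hF.
  apply: (@zero_integral_cvg _ _ _ mu
      (fun n x => \sum_(0 <= k < n) h x * \1_(F k) (Y x)) _
      (fun x => `|h x|)).
  + by move=> n; exact: zero_integral_sum.
  + move=> x; under eq_fun do rewrite -mulr_sumr sum_indic_trivIset//.
    apply: cvgMr; rewrite [X in _ --> X]indicE.
    have [/set_mem[j _ Fj]|nF] := boolP (Y x \in \bigcup_k F k).
      apply: cvg_near_cst; exists j.+1 => // n /= jn.
      by rewrite indicE mem_set//; exists j.
    apply: cvg_near_cst; apply: nearW => n; rewrite indicE memNset// => -[i _ Fi].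
    by move/negP: nF; apply; apply/mem_set; exists i.
  + exact: (integrable_norm h0.1).
  + move=> n x; rewrite -mulr_sumr sum_indic_trivIset// normrM ler_piMr//.
    by rewrite indicE; case: (_ \in _); rewrite ?normr1 ?normr0.
Qed.

(** The function [exp (- n exp (n t))] is bounded by 1 and tends to the
    indicator of the negative half-line. The factor [n] in front of the inner
    exponential settles the value at [t = 0]: without it the limit there would
    be [exp (-1)] and boundary points would need a separate argument. *)
Lemma cvg_expR_step (t : R) :
  expR (- n%:R * expR (n%:R * t)) @[n --> \oo] --> ((t < 0)%R%:R : R).
Proof.
have [t0|t0] := ltP t 0; last first.
  have E0 : expR (- 1 : R) ^+ n @[n --> \oo] --> (0 : R).
    by apply: cvg_expr; rewrite ger0_norm ?expR_ge0// expR_lt1// ltrN10.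
  apply: (squeeze_cvgr _ (cvg_cst (0 : R)) E0).
  apply: nearW => n; rewrite expR_ge0 /= -expRM_natl ler_expR.
  rewrite mulNr mulrN1 lerN2 ler_peMr// -expR0 ler_expR.
  by rewrite mulr_ge0.
have E1 : 1 - (4 / t ^+ 2) * n%:R^-1 @[n --> \oo] --> (1 : R).
  rewrite -[X in _ --> X]subr0 -[X in _ - X](mulr0 (4 / t ^+ 2)).
  apply: cvgB; first exact: cvg_cst.
  apply: cvgMr; rewrite -(@cvg_shiftS _ (fun n => n%:R^-1 : R)).
  exact: cvg_harmonic.
have -> : (true : nat)%:R = 1 :> R by [].
apply: (squeeze_cvgr _ E1 (cvg_cst (1 : R))).
near=> n.
have n0 : (0 : R) < n%:R by rewrite ltr0n; near: n; exact: nbhs_infty_gt.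
apply/andP; split; last first.
  by rewrite -[leRHS]expR0 ler_expR mulNr oppr_le0 mulr_ge0 ?expR_ge0.
rewrite mulNr.
rewrite (le_trans _ (expR_ge1Dx _))// lerD2l lerN2.
have H : (n%:R * (- t) / 2) ^+ 2 <= expR (n%:R * (- t)).
  have -> : expR (n%:R * (- t)) = expR (n%:R * (- t) / 2) ^+ 2.
    by rewrite -expRM_natl; congr expR; field.
  have p0 : 0 <= n%:R * (- t) / 2 by rewrite divr_ge0 ?mulr_ge0 ?oppr_ge0 ?ltW.
  rewrite lerXn2r ?nnegrE ?expR_ge0//.
  by rewrite (le_trans _ (expR_ge1Dx _))// lerDr.
have -> : n%:R * t = - (n%:R * (- t)) by rewrite mulrN opprK.
rewrite expRN.
have P0 : 0 < (n%:R * (- t) / 2) ^+ 2.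
  by rewrite exprn_gt0// divr_gt0 ?mulr_gt0 ?oppr_gt0.
have -> : 4 / t ^+ 2 / n%:R = n%:R * ((n%:R * (- t) / 2) ^+ 2)^-1.
  by field; rewrite ?(gt_eqF n0) ?(lt_eqF t0).
by rewrite ler_wpM2l ?lef_pV2 ?posrE ?expR_gt0// ltW.
Unshelve. all: by end_near. Qed.

(** Uniqueness for the one-dimensional Laplace transform on the nonnegative
    integers. For each fixed [n] the step function approximating the indicator
    of [Y < c] is an entire function of [exp (n Y)], so it is orthogonal to [h];
    letting [n] tend to infinity gives half-lines, then all Borel sets. *)
Lemma zero_integral_preimage (Y : T -> R) h C :
  measurable_fun setT Y -> (forall x, h x != 0 -> `|Y x| <= C) ->
  (forall n, zero_integral (fun x => h x * expR (n%:R * Y x))) ->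
  forall A : set R, measurable A -> zero_integral (fun x => h x * \1_A (Y x)).
Proof.
move=> mY YC hY; have h0 : zero_integral h.
  by have := hY 0; under eq_fun do rewrite mul0r expR0 mulr1.
apply: (zero_integral_dynkin (G := @RGenInftyO.G R)) => //.
- exact: RGenInftyO.measurableE.
- move=> _ _ [a ->] [b ->]; exists (Order.min a b).
  by apply/seteqP; split => x /=; rewrite !in_itv /= lt_min => /andP.
move=> _ [c ->].
apply: (@zero_integral_cvg _ _ _ mu (fun n x =>
    h x * expR ((- n%:R * expR (- (n%:R * c))) * expR (n%:R * Y x))) _
    (fun x => `|h x|)).
- move=> n; apply: (@zero_integral_expR _ _ _ mu _ _ (expR (n%:R * C))).
  + by apply: measurableT_comp => //; exact: measurable_funM.
  + move=> x /YC xC; rewrite ger0_norm ?expR_ge0// ler_expR ler_wpM2l//.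
    by rewrite (le_trans _ xC)// ler_norm.
  + move=> k; have := hY (k * n)%N.
    by under eq_fun do rewrite natrM -mulrA expRM_natl.
- move=> x; apply: cvgMr.
  under eq_fun do rewrite -mulrA -expRD addrC -mulrBr.
  rewrite indicE mem_setE in_itv /= -subr_lt0.
  exact: cvg_expR_step.
- exact: (integrable_norm h0.1).
- by move=> n x; rewrite normrM ler_piMr// ger0_norm ?expR_ge0.
Qed.

Lemma ae_eq0_zero_integral h :
  (forall A, measurable A -> zero_integral (fun x => h x * \1_A x)) ->
  {ae mu, forall x, h x = 0}.
Proof.
move=> hA.
have hi : mu.-integrable setT (EFin \o h).
  by have [+ _] := hA setT measurableT; under eq_fun do rewrite indicT mulr1.
have /= := @integral_ae_eq _ T R mu setT measurableT (cst 0%E) (EFin \o h) hi.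
move=> /(_ (measurable_cst _)) H.
have {}H := H _.
have: ae_eq mu setT (EFin \o h) (cst 0%E).
  apply: H => E _ mE; rewrite integral0 integral_mkcond.
  have [_ <-] := hA E mE; apply: eq_integral => x _.
  rewrite patchE indicE /=; case: (x \in E); by rewrite ?mulr1 ?mulr0.
by apply: filterS => x /(_ I) /= [].
Qed.

End ZeroIntegralIndic.

(** * Plane Lebesgue measure and the Laplace transform *)

Section PlaneMeasure.
Context {R : realType}.
Implicit Types (A Omega : set (R * R)) (f g : R * R -> R).
Local Notation plane := (measurableTypeR R * measurableTypeR R)%type.
Local Notation mu := (@leb2 R).

(** An open set is the countable union of the rational squares it contains. *)
Lemma measurable_open_plane A : open A -> @measurable _ plane A.
Proof.
move=> oA.
pose box (q : rat * rat * rat) : set plane :=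
  `]ratr q.1.1 - ratr q.2, ratr q.1.1 + ratr q.2[ `*`
  `]ratr q.1.2 - ratr q.2, ratr q.1.2 + ratr q.2[.
have -> : A = \bigcup_q (if `[< box q `<=` A >] then box q else set0).
  apply/seteqP; split => [[x1 x2] Ax|x [q _]]; last first.
    by case: asboolP => // + ?; apply.
  have [e /= e0 eA] := open_subball oA Ax.
  have e4 : 0 < e / 4 by rewrite divr_gt0.
  have {}eA y1 y2 : `|x1 - y1| < e / 2 -> `|x2 - y2| < e / 2 -> A (y1, y2).
    move=> h1 h2; apply: (eA (e / 2)).
    - by rewrite /= sub0r normrN gtr0_norm ?divr_gt0// ltr_pdivrMr// ltr_pMr// ltr1n.
    - by rewrite divr_gt0.
    - by split; rewrite /ball /=.
  have [r] := rat_in_itvoo e4.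
  rewrite in_itv /= => /andP[r0 re].
  have [q1] : exists q, ratr q \in `]x1 - ratr r, x1 + ratr r[%R.
    have [|q qx] := @rat_in_itvoo R (x1 - ratr r) (x1 + ratr r); first by lra.
    by exists q.
  have [q2] : exists q, ratr q \in `]x2 - ratr r, x2 + ratr r[%R.
    have [|q qx] := @rat_in_itvoo R (x2 - ratr r) (x2 + ratr r); first by lra.
    by exists q.
  rewrite !in_itv /= => q2x q1x.
  exists (q1, q2, r) => //; rewrite ifT; last first.
    apply/asboolP => -[y1 y2] [] /=; rewrite !in_itv /= => y1q y2q.
    apply: eA.
    - by rewrite ltr_norml; lra.
    - by rewrite ltr_norml; lra.
  by split; rewrite /= in_itv /=; lra.
apply: countable_bigcupT_measurable => // q; case: asboolP => // _.
exact: measurableX.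
Qed.

Lemma measurable_fun_open_continuous (D : set (R * R)) f :
  open D -> {in D, continuous f} -> @measurable_fun _ _ plane (measurableTypeR R) D f.
Proof.
move=> oD cf; apply: (measurability _ (RGenOpens.measurableE R)).
move=> _ [_ [a [b ->] <-]]; apply: measurable_open_plane.
rewrite openE => x [Dx fx]; apply: filterI; first exact: open_nbhs_nbhs.
by apply: (cf x (mem_set Dx)); apply: open_nbhs_nbhs; split => //; exact: interval_open.
Qed.

Lemma leb2X (A B : set (measurableTypeR R)) : measurable A -> measurable B ->
  mu (A `*` B) = (lebesgue_measure A * lebesgue_measure B)%E.
Proof. exact: product_measure1E. Qed.

(** A square inside the open set has positive measure, so it is not contained in
    the exceptional null set. *)
Lemma ae_in_open_exists (U : set (R * R)) (P : R * R -> Prop) :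
  open U -> U !=set0 -> ae_in U P -> exists2 x, U x & P x.
Proof.
move=> oU [[x1 x2] Ux] [N [mN N0 UN]].
apply: contrapT => nP.
have UsubN : U `<=` N.
  move=> y Uy; apply: UN => /= /(_ Uy) Py; apply: nP; by exists y.
have [e /= e0 eU] := open_subball oU Ux.
pose r := e / 2.
have r0 : 0 < r by rewrite divr_gt0.
pose B : set plane := `]x1 - r, x1 + r[ `*` `]x2 - r, x2 + r[.
have BU : B `<=` U.
  move=> [y1 y2] [] /=; rewrite !in_itv /= => h1 h2; apply: (eU r) => //.
  - by rewrite /= sub0r normrN gtr0_norm// /r ltr_pdivrMr// ltr_pMr// ltr1n.
  - by split; rewrite /ball /= ltr_norml; lra.
have mB : measurable B by exact: measurableX.
have : (mu B <= mu N)%E.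
  by apply: le_measure; rewrite ?inE//; exact: subset_trans UsubN.
rewrite N0 /B leb2X//= !lebesgue_measure_itv/= !lte_fin.
rewrite !ifT; [|lra..].
by rewrite -!EFinB -EFinM lee_fin leNgt mulr_gt0//; lra.
Qed.

(** Uniqueness for the Laplace transform in the plane: apply the
    one-dimensional statement in each variable in turn, first to reach the sets
    [A * R], then the rectangles [A * B], which generate the Borel sets. *)
Lemma laplace_eq0 Omega (xi0 : R * R) f : bounded_set Omega ->
  (forall m n : nat, zero_integral mu
    ((fun x => f x * expR (dot (xi0 + (m%:R, n%:R)) x)) \_ Omega)) ->
  ae_in Omega (fun x => f x = 0).
Proof.
move=> [M [_ OM]] f0.
pose C : R := `|M| + 1.
have {}OM x : Omega x -> `|x| <= C.
  by move=> Ox; apply: OM => //; rewrite /C ltr_pwDr// ler_norm.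
pose h (x : plane) := (f \_ Omega) x * expR (dot xi0 x).
pose Z := @zero_integral _ plane R mu.
have fst_le x : Omega x -> `|x.1| <= C.
  by move=> /OM; rewrite prod_normE ge_max => /andP[].
have snd_le x : Omega x -> `|x.2| <= C.
  by move=> /OM; rewrite prod_normE ge_max => /andP[].
have hZ (m n : nat) : Z (fun x => h x * expR (n%:R * x.2) * expR (m%:R * x.1)).
  have E (x : plane) : h x * expR (n%:R * x.2) * expR (m%:R * x.1) =
      ((fun x => f x * expR (dot (xi0 + (m%:R, n%:R)) x)) \_ Omega) x.
    rewrite /h !patchE; case: ifP => _; last by rewrite !mul0r.
    rewrite -!mulrA -!expRD; congr (_ * expR _).
    by rewrite /dot /=; ring.
  by rewrite (funext E); exact: f0.
have hO (x : plane) : h x != 0 -> Omega x.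
  rewrite /h patchE; case: ifPn => [/set_mem//|_]; by rewrite mul0r eqxx.
(* the second variable is kept exponential while the first one is localised *)
have h1 n (A : set R) : measurable A ->
    Z (fun x => h x * expR (n%:R * x.2) * \1_A x.1).
  move=> mA; apply: (@zero_integral_preimage _ plane R mu fst
      (fun x => h x * expR (n%:R * x.2)) C _ _ _ A mA) => //.
    by move=> x hx; apply/fst_le/hO; apply: contra_neq hx => ->; rewrite mul0r.
  by move=> m; exact: hZ.
have h2 (P Q : set R) : measurable P -> measurable Q ->
    Z (fun x => h x * \1_P x.1 * \1_Q x.2).
  move=> mP mQ; apply: (@zero_integral_preimage _ plane R mu snd
      (fun x => h x * \1_P x.1) C _ _ _ Q mQ) => //.
    by move=> x hx; apply/snd_le/hO; apply: contra_neq hx => ->; rewrite mul0r.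
  by move=> n; under eq_fun do rewrite mulrAC; exact: h1.
have h3 (S : set plane) : measurable S -> Z (fun x => h x * \1_S x).
  apply: (@zero_integral_dynkin _ plane R mu _ plane id
    [set A `*` B | A in measurable & B in measurable]).
  - exact: measurable_prod_measurableType.
  - move=> _ _ [A1 mA1 [B1 mB1 <-]] [A2 mA2 [B2 mB2 <-]].
    exists (A1 `&` A2); first exact: measurableI.
    by exists (B1 `&` B2); [exact: measurableI|rewrite setXI].
  - by have := hZ 0 0; under eq_fun do rewrite !mul0r expR0 !mulr1.
  - move=> _ [A mA [B mB <-]]; have := h2 A B mA mB.
    congr Z; apply/funext => x; rewrite -mulrA; congr (_ * _).
    rewrite !indicE -natrM mulnb; congr (_%:R); congr nat_of_bool.
    by rewrite in_setX.
have := ae_eq0_zero_integral h3; apply: filterS => x /= + Ox.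
rewrite /h patchE mem_set// => /eqP; rewrite mulf_eq0 => /orP[/eqP//|].
by rewrite gt_eqF ?expR_gt0.
Qed.

End PlaneMeasure.

(** * Partial derivatives of compactly supported functions *)

Section IntegralPartial.
Context {R : realType}.
Implicit Types (h : R * R -> R) (f : R -> R).
Local Notation plane := (measurableTypeR R * measurableTypeR R)%type.
Local Notation mu := (@leb2 R).
Local Notation e1 := ((1, 0) : R * R).
Local Notation e2 := ((0, 1) : R * R).

Lemma derive_eq0_near (V : normedModType R) (g : V -> R) (x v : V) :
  (\forall y \near x, g y = 0) -> 'D_v g x = 0.
Proof.
move=> g0; rewrite -(derive_cst (0 : R) x v).
by apply: near_eq_derive.
Qed.

(** Fundamental theorem of calculus on a segment large enough to contain the
    support in its interior. *)
Lemma integral_derive1_eq0 f (r : R) :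
  (forall t, derivable f t 1) -> continuous (derive1 f) ->
  (forall t, r < `|t| -> f t = 0) ->
  (\int[lebesgue_measure]_t (derive1 f t)%:E = 0)%E.
Proof.
move=> df cf f0; pose b : R := `|r| + 1.
have b0 : 0 < b by rewrite ltr_wpDl.
have rb : r < b by rewrite /b (le_lt_trans (ler_norm r))// ltrDl.
have f'0 t : r < `|t| -> derive1 f t = 0.
  move=> rt; rewrite derive1E; apply: derive_eq0_near.
  near=> s; apply: f0; near: s.
  have := @cvgr_gt _ _ _ _ (fun s : R => `|s|) `|t| _ r rt.
  apply; exact: (@norm_continuous _ _ t).
have cont : continuous f.
  by move=> t; apply/differentiable_continuous/derivable1_diffP.
transitivity (\int[lebesgue_measure]_(t in `[(- b)%R, b%R]) (derive1 f t)%:E)%E.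
  rewrite [RHS]integral_mkcond; apply: eq_integral => t _; rewrite patchE.
  case: ifPn => //; rewrite notin_setE /= in_itv /= => tb; rewrite f'0//.
  rewrite ltNge; apply/negP => tr; apply: tb; rewrite -ler_norml.
  by rewrite (le_trans tr)// ltW.
rewrite (@continuous_FTC2 _ _ f) ?gtrN//.
- rewrite !f0 ?subee// ?normrN; first by rewrite (lt_le_trans rb)// ler_norm.
  by rewrite (lt_le_trans rb)// ler_norm.
- exact: continuous_subspaceT.
- split.
  + by move=> t _; exact: df.
  + by apply: cvg_within_filter; exact: cont.
  + by apply: cvg_within_filter; exact: cont.
Unshelve. all: by end_near. Qed.

Let quotient_e1 h (x y : R) :
  (fun t => t^-1 *: ((h \o shift (x, y)) (t *: e1) - h (x, y))) =
  (fun t => t^-1 *: ((fun s => h (s, y)) (t + x) - h (x, y))).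
Proof.
apply/funext => t /=; congr (_ *: (h _ - _)).
by congr pair; rewrite /= /GRing.scale /= ?mulr1 ?mulr0 ?add0r.
Qed.

Let quotient_e2 h (x y : R) :
  (fun t => t^-1 *: ((h \o shift (x, y)) (t *: e2) - h (x, y))) =
  (fun t => t^-1 *: ((fun s => h (x, s)) (t + y) - h (x, y))).
Proof.
apply/funext => t /=; congr (_ *: (h _ - _)).
by congr pair; rewrite /= /GRing.scale /= ?mulr1 ?mulr0 ?add0r.
Qed.

Lemma derive_e1E h (x y : R) : 'D_e1 h (x, y) = derive1 (fun t => h (t, y)) x.
Proof. by rewrite /derive quotient_e1. Qed.

Lemma derive_e2E h (x y : R) : 'D_e2 h (x, y) = derive1 (fun t => h (x, t)) y.
Proof. by rewrite /derive quotient_e2. Qed.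

Let derivable1E f (x : R) :
  derivable f x 1 = cvg ((fun t => t^-1 *: (f (t + x) - f x)) @ 0^').
Proof.
rewrite /derivable; have -> // : (fun t => t^-1 *: ((f \o shift x) (t *: 1) - f x)) =
  (fun t => t^-1 *: (f (t + x) - f x)).
by apply/funext => t /=; rewrite [t%:A]mulr1.
Qed.

Lemma derivable_e1 h (x y : R) :
  derivable h (x, y) e1 -> derivable (fun t => h (t, y)) x 1.
Proof. by rewrite derivable1E /derivable quotient_e1. Qed.

Lemma derivable_e2 h (x y : R) :
  derivable h (x, y) e2 -> derivable (fun t => h (x, t)) y 1.
Proof. by rewrite derivable1E /derivable quotient_e2. Qed.

Lemma continuous_bounded_support_integrable h (r : R) :
  continuous h -> (forall x, r < `|x| -> h x = 0) ->
  mu.-integrable setT (EFin \o h).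
Proof.
move=> ch h0; pose b : R := `|r| + 1.
have b0 : 0 < b by rewrite ltr_wpDl.
have rb : r < b by rewrite /b (le_lt_trans (ler_norm r))// ltrDl.
pose B : set plane := `[(- b), b] `*` `[(- b), b].
have mB : measurable B by exact: measurableX.
have hB : h = h \_ B.
  apply/funext => -[x y]; rewrite patchE; case: ifPn => //.
  rewrite notin_setE /B /= !in_itv /= => nB; apply: h0.
  rewrite ltNge; apply/negP; rewrite prod_normE ge_max => /andP[xr yr].
  by apply: nB; rewrite -!ler_norml !(le_trans _ (ltW rb)).
have cB : compact (B : set (R * R)).
  by apply: compact_setX; exact: segment_compact.
rewrite hB -restrict_EFin; apply/integrable_restrict => //; rewrite setTI.
apply: measurable_bounded_integrable => //.
- rewrite leb2X//= !lebesgue_measure_itv/= lte_fin gtrN//.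
  by rewrite -EFinB -EFinM ltry.
- apply: measurable_funTS; apply: measurable_fun_open_continuous; first exact: openT.
  by move=> x _; exact: ch.
- have [M [Mr MB]] := compact_bounded (continuous_compact (continuous_subspaceT ch) cB).
  by exists M; split => // y My x Bx; apply: (MB y My); exists x.
Qed.

Section Partial.
Variables (h : R * R -> R) (r : R).
Hypothesis h_der : forall x v, derivable h x v.
Hypothesis h_supp : forall x, r < `|x| -> h x = 0.

Let supp_partial v x : r < `|x| -> 'D_v h x = 0.
Proof.
move=> rx; apply: derive_eq0_near; near=> y; apply: h_supp; near: y.
have := @cvgr_gt _ _ _ _ (fun s : R * R => `|s|) `|x| _ r rx.
apply; exact: (@norm_continuous _ _ x).
Unshelve. all: by end_near. Qed.

Lemma integrable_partial v : continuous ('D_v h) ->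
  mu.-integrable setT (EFin \o 'D_v h).
Proof.
move=> ch; apply: (@continuous_bounded_support_integrable _ r) => // x.
exact: supp_partial.
Qed.

(** Divergence theorem for compactly supported fields, one coordinate at a
    time: integrate first in the direction of differentiation. *)
Lemma integral_partial1_eq0 : continuous ('D_e1 h) ->
  (\int[mu]_x ('D_e1 h x)%:E = 0)%E.
Proof.
move=> ch; transitivity
    (\int[lebesgue_measure]_y fubini_G lebesgue_measure (EFin \o 'D_e1 h) y)%E.
  by apply/esym/integral21_prod_meas1; exact: integrable_partial.
rewrite -[RHS](integral0 lebesgue_measure setT); apply: eq_integral => y _.
rewrite /fubini_G /=; under eq_integral do rewrite derive_e1E.
apply: (@integral_derive1_eq0 _ r).
- by move=> t; apply: derivable_e1; exact: h_der.
- have -> : derive1 (fun t => h (t, y)) = 'D_e1 h \o (fun t => (t, y)).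
    by apply/funext => t; rewrite /= derive_e1E.
  move=> t; apply: continuous_comp; last exact: ch.
  by apply: (cvg_pair (F := nbhs t) (G := nbhs t) (H := nbhs y));
    [exact: cvg_id|exact: cvg_cst].
- move=> t rt; apply: h_supp; rewrite prod_normE lt_max.
  by rewrite rt.
Qed.

Lemma integral_partial2_eq0 : continuous ('D_e2 h) ->
  (\int[mu]_x ('D_e2 h x)%:E = 0)%E.
Proof.
move=> ch; transitivity
    (\int[lebesgue_measure]_y fubini_F lebesgue_measure (EFin \o 'D_e2 h) y)%E.
  by apply/esym/integral12_prod_meas1; exact: integrable_partial.
rewrite -[RHS](integral0 lebesgue_measure setT); apply: eq_integral => x _.
rewrite /fubini_F /=; under eq_integral do rewrite derive_e2E.
apply: (@integral_derive1_eq0 _ r).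
- by move=> t; apply: derivable_e2; exact: h_der.
- have -> : derive1 (fun t => h (x, t)) = 'D_e2 h \o (fun t => (x, t)).
    by apply/funext => t; rewrite /= derive_e2E.
  move=> t; apply: continuous_comp; last exact: ch.
  by apply: (cvg_pair (F := nbhs t) (G := nbhs x) (H := nbhs t));
    [exact: cvg_cst|exact: cvg_id].
- move=> t rt; apply: h_supp; rewrite prod_normE lt_max.
  by rewrite rt orbT.
Qed.

End Partial.

End IntegralPartial.

(** * Rays in a strictly convex domain *)

Section Plane.
Context {R : realType}.
Implicit Types (x y v theta eta zeta : R * R) (Omega S : set (R * R)).

Lemma dotC x y : dot x y = dot y x.
Proof. by rewrite /dot; ring. Qed.

Lemma dotDl x y v : dot (x + y) v = dot x v + dot y v.
Proof. by rewrite /dot /=; ring. Qed.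

Lemma dotZl (a : R) x y : dot (a *: x) y = a * dot x y.
Proof. by rewrite /dot /= /GRing.scale /=; ring. Qed.

Lemma dotNr x y : dot x (- y) = - dot x y.
Proof. by rewrite /dot /=; ring. Qed.

Lemma strictly_convex_convex Omega x y (t : R) :
  strictly_convex Omega -> Omega x -> Omega y -> 0 <= t <= 1 ->
  Omega (t *: x + (1 - t) *: y).
Proof.
move=> cO Ox Oy /andP[t0 t1].
have [->|/eqP xy] := eqVneq x y.
  by rewrite -scalerDl addrCA subrr addr0 scale1r.
move: t0; rewrite le_eqVlt => /predU1P[<-|t0].
  by rewrite scale0r add0r subr0 scale1r.
move: t1; rewrite le_eqVlt => /predU1P[->|t1].
  by rewrite subrr scale0r addr0 scale1r.
apply: interior_subset; apply: cO => //; last exact/andP.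
- exact: subset_closure.
- exact: subset_closure.
Qed.

(** Stated with [f 0 <= 0] only, since that is all that is known of the boundary
    graph below; continuity and positivity on the right force [f 0 = 0]. *)
Lemma derive_ge0_right (f : R -> R) (l d : R) :
  is_derive (0 : R) (1 : R) f l -> 0 < d -> f 0 <= 0 ->
  (forall e, 0 < e < d -> 0 < f e) -> 0 <= l.
Proof.
move=> fl d0 f00 fpos.
have df : derivable f 0 1 by [].
have pos : \forall e \near (0 : R)^'+, 0 < f e.
  exists d => //= e ed e0; apply: fpos; move: ed.
  by rewrite /ball_ /= sub0r normrN gtr0_norm// e0.
have cf : f e @[e --> 0^'+] --> f 0.
  apply: cvg_within_filter.
  by apply: differentiable_continuous; exact/derivable1_diffP.
have f0 : f 0 = 0.
  apply/eqP; rewrite eq_le f00 /=.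
  by apply: (cvgr_to_ge cf); apply: filterS pos => e /ltW.
have : h^-1 *: ((f \o shift 0) (h *: 1) - f 0) @[h --> 0^'+] --> l.
  rewrite -(@derive_val _ _ _ _ _ _ _ fl).
  have := df; rewrite /derivable; apply: cvg_trans; apply: cvg_app.
  by apply: within_subset => e /=; rewrite lt_def => /andP[].
move/cvgr_to_ge; apply; near=> e.
have e0 : 0 < e by [].
rewrite /= f0 subr0 addr0 [e%:A]mulr1 /GRing.scale /= mulr_ge0 ?invr_ge0 ?ltW//.
by near: e.
Unshelve. all: by end_near. Qed.

Lemma perpP v : dot v v = 1 -> dot (perp v) v = 0 /\ dot (perp v) (perp v) = 1.
Proof. by rewrite /dot /perp /= => v1; split; [ring|rewrite -v1; ring]. Qed.

Lemma near_ray x v (P : set (R * R)) : nbhs x P ->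
  \forall t \near (0 : R)^'+, P (x + t *: v).
Proof.
have : x + t *: v @[t --> (0 : R)^'+] --> x.
  rewrite -[X in _ --> X]addr0; apply: cvgD; first exact: cvg_cst.
  rewrite -(scale0r v); apply: cvg_within_filter.
  by apply: cvgZr_tmp; exact: cvg_id.
by move=> H /H.
Qed.

Lemma open_ray Omega x v : open Omega -> Omega x ->
  exists2 d : R, 0 < d & Omega (x + d *: v).
Proof.
move=> oO Ox; have [d [? ?]] : exists d : R, 0 < d /\ Omega (x + d *: v).
  apply: (@filter_ex _ (0 : R)^'+); near=> d; split=> //; near: d.
  by apply: near_ray; exact: open_nbhs_nbhs.
by exists d.
Unshelve. all: by end_near. Qed.

(** The vector [N = n - l perp n] is a positive multiple of the outer normal.
    By convexity every segment from a point of the domain to [zeta] stays in the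
    domain, so differentiating the chart along it at [zeta] gives
    [dot (y - zeta) N <= 0] for all [y] in the domain. Using this at a point
    slightly displaced from [x] in the direction [N] makes the inequality strict
    at [x]. *)
Lemma exit_transversal Omega (alpha : R) x zeta :
  open Omega -> strictly_convex Omega -> C2_holder_boundary alpha Omega ->
  Omega x -> closure Omega zeta -> ~ Omega zeta ->
  boundary Omega zeta /\
  exists2 eta, outer_normal Omega zeta eta & 0 < dot eta (zeta - x).
Proof.
move=> oO cO bO Ox clz nOz.
have bz : boundary Omega zeta by split => // /interior_subset.
split=> //.
have [n [r [gamma [[n1 r0 chart] [dgamma _]]]]] := bO _ bz.
have dg0 : derivable gamma 0 1 by apply: (dgamma 0 _).1 => /=; rewrite oppr_lt0 r0.
have [pn pp] := perpP n1.
set l := derive1 gamma 0.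
have gamma0 : gamma 0 <= 0.
  rewrite leNgt; apply/negP => g0; apply: nOz; apply/chart.
    by rewrite subrr /dot /= !mul0r addr0 exprn_gt0.
  by rewrite subrr /dot /= !mul0r addr0.
have supp y : Omega y -> dot (y - zeta) (n - l *: perp n) <= 0.
  move=> Oy; set w := y - zeta.
  have seg e : 0 < e < 1 -> Omega (zeta + e *: w).
    move=> e01; apply: interior_subset.
    have -> : zeta + e *: w = e *: y + (1 - e) *: zeta.
      by rewrite /w scalerBr scalerBl scale1r addrCA addrA.
    apply: cO => //; first exact: subset_closure.
    by move=> yz; apply: nOz; rewrite -yz.
  (* for e < d the point zeta + e w lies in the chart's disc, as
     e^2 |w|^2 <= (e (1 + |w|^2))^2 < r^2 *)
  pose d := Num.min 1 (r / (1 + dot w w)).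
  have ww0 : 0 <= dot w w by rewrite /dot addr_ge0// -expr2 sqr_ge0.
  have w1 : 0 < 1 + dot w w by rewrite ltr_wpDr.
  have d0 : 0 < d by rewrite lt_min ltr01 divr_gt0.
  have D : is_derive (0 : R) (1 : R)
      (fun e => gamma (e * dot w (perp n)) - e * dot w n)
      (l * dot w (perp n) - dot w n).
    have Dlin (b : R) : is_derive (0 : R) (1 : R) (fun e => e * b) b.
      have -> : (fun e => e * b) = b *: id.
        by apply/funext => e; rewrite /GRing.scale /= mulrC.
      by apply: is_derive_eq; rewrite /GRing.scale /= mulr1.
    apply: is_deriveB; apply: (@is_derive1_comp _ gamma) => //.
    rewrite mul0r; apply: DeriveDef => //.
    by rewrite /l derive1E.
  have := derive_ge0_right D d0; rewrite !mul0r subr0 => /(_ gamma0).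
  have -> : dot w (n - l *: perp n) = - (l * dot w (perp n) - dot w n).
    by rewrite /dot /= /GRing.scale /=; ring.
  rewrite oppr_le0; apply => e /andP[e0]; rewrite lt_min => /andP[e1 er].
  rewrite subr_gt0.
  have : zeta + e *: w - zeta = e *: w by rewrite addrC addKr.
  move=> E; have := chart (zeta + e *: w); rewrite E !dotZl.
  case=> [|+ _]; last by apply; apply: seg; rewrite e0.
  rewrite dotC dotZl mulrA -expr2.
  move: er; rewrite ltr_pdivlMr// => er.
  apply: (@le_lt_trans _ _ ((e * (1 + dot w w)) ^+ 2)).
    rewrite exprMn ler_wpM2l ?sqr_ge0//.
    by nra.
  by rewrite ltrXn2r ?nnegrE ?mulr_ge0 ?ltW.
set N := n - l *: perp n.
have NN : dot N N = 1 + l ^+ 2.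
  have -> : dot N N = dot n n - 2 * l * dot (perp n) n + l ^+ 2 * dot (perp n) (perp n).
    by rewrite /N /dot /= /GRing.scale /=; ring.
  by rewrite n1 pn pp; ring.
have NN0 : 0 < dot N N by rewrite NN ltr_wpDr ?sqr_ge0.
have [d d0 Od] := open_ray N oO Ox.
exists ((Num.sqrt (1 + l ^+ 2))^-1 *: N).
  by exists n, r, gamma; split.
rewrite dotZl mulr_gt0 ?invr_gt0 ?sqrtr_gt0 -?NN//.
have := supp _ Od; rewrite -/N.
have -> : x + d *: N - zeta = d *: N + (x - zeta) by rewrite addrAC addrC.
rewrite dotDl dotZl => H.
have -> : dot N (zeta - x) = - dot (x - zeta) N by rewrite /dot /=; ring.
have := mulr_gt0 d0 NN0; lra.
Qed.

(** Compares the Euclidean unit circle with the max norm that defines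
    boundedness. *)
Lemma circle_norm_ge theta : circle theta -> 1 / 2 <= `|theta|.
Proof.
rewrite /circle /dot /= => th1; rewrite leNgt; apply/negP.
rewrite prod_normE gt_max => /andP[]; rewrite !ltr_norml => /andP[? ?] /andP[? ?].
by nra.
Qed.

Lemma bounded_ray Omega : bounded_set Omega ->
  exists2 M : R, 0 < M & forall x theta (t : R), circle theta -> 0 <= t ->
    Omega x -> Omega (x + t *: theta) -> t <= M.
Proof.
move=> [M0 [_ OM]]; pose M : R := `|M0| + 1.
have {}OM x : Omega x -> `|x| <= M.
  by move=> Ox; apply: OM => //; rewrite /M ltr_pwDr// ler_norm.
have M_gt0 : 0 < M by rewrite /M ltr_wpDl.
exists (4 * M); first by rewrite mulr_gt0.
move=> x theta t /circle_norm_ge th t0 /OM xM /OM xtM.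
have : `|t *: theta| <= M + M.
  by rewrite -[t *: theta](addKr x) addrC (le_trans (ler_normB _ _))// lerD.
rewrite normrZ ger0_norm// => H.
have : t * (1 / 2) <= t * `|theta| by rewrite ler_wpM2l.
lra.
Qed.

(** [T] is the supremum of the times spent in the domain; convexity makes this
    set of times an interval and openness excludes its right end. *)
Lemma exit_point Omega x theta :
  open Omega -> bounded_set Omega -> strictly_convex Omega ->
  Omega x -> circle theta ->
  exists T : R, [/\ 0 < T, forall t, 0 <= t < T -> Omega (x + t *: theta),
    ~ Omega (x + T *: theta) & closure Omega (x + T *: theta)].
Proof.
move=> oO bO cO Ox cth.
have [M _ OM] := bounded_ray bO.
pose A : set R := [set t | 0 <= t /\ Omega (x + t *: theta)].
have A0 : A 0 by split=> //; rewrite scale0r addr0.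
have supA : has_sup A.
  split; first by exists 0.
  by exists M => t [t0 Ot]; exact: (OM _ _ _ cth t0 Ox Ot).
have leT t : A t -> t <= sup A by move=> At; apply: ub_le_sup => //; exact: supA.2.
have [d d0 Od] := open_ray theta oO Ox.
have T0 : 0 < sup A by apply: (lt_le_trans d0); apply: leT; split => //; exact: ltW.
have inO t : 0 <= t < sup A -> Omega (x + t *: theta).
  move=> /andP[t0 tT].
  have [a [a0 Oa] ta] := sup_gt supA.1 tT.
  have a_gt0 : 0 < a by exact: le_lt_trans ta.
  have -> : x + t *: theta =
      (t / a) *: (x + a *: theta) + (1 - t / a) *: x.
    rewrite scalerDr scalerA divfK ?gt_eqF// scalerBl scale1r.
    by rewrite addrAC addrCA subrr addr0.
  apply: strictly_convex_convex => //.
  by rewrite divr_ge0//= ler_pdivrMr// mul1r ltW.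
exists (sup A); split => //.
  move=> OT; have [e e0 Oe] := open_ray theta oO OT.
  have : sup A + e <= sup A.
    apply: leT; split; first by rewrite addr_ge0 ?ltW.
    by rewrite scalerDl addrA.
  by rewrite gerDl leNgt e0.
move=> B nB.
have [e [eT Be]] : exists e : R, 0 < e < sup A /\ B (x + sup A *: theta + e *: - theta).
  apply: (@filter_ex _ (0 : R)^'+); near=> e; split.
    by apply/andP; split => //; near: e; exact: nbhs_right_lt.
  by near: e; exact: near_ray.
exists (x + sup A *: theta + e *: - theta); split => //.
rewrite scalerN -addrA -scalerBl; apply: inO; lra.
Unshelve. all: by end_near. Qed.

End Plane.

(** * Compact support of solutions with zero boundary values *)

Section Transport.
Context {R : realType}.
Implicit Types (x y v theta eta zeta : R * R) (Omega S : set (R * R)).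
Implicit Types (w : R * R -> R).
Local Notation e1 := ((1, 0) : R * R).
Local Notation e2 := ((0, 1) : R * R).

Lemma dot_grad w x v : differentiable w x -> dot v (grad w x) = 'D_v w x.
Proof.
move=> dw; rewrite /dot /grad /= !deriveE//.
have {3}-> : v = v.1 *: e1 + v.2 *: e2.
  by case: v => a b; congr pair; rewrite /= /GRing.scale /= ?mulr0 ?mulr1 ?addr0 ?add0r.
by rewrite linearD !linearZ.
Qed.

Lemma is_derive_line w x v (t : R) : differentiable w (x + t *: v) ->
  is_derive t (1 : R) (fun s => w (x + s *: v)) (dot v (grad w (x + t *: v))).
Proof.
move=> dw; rewrite dot_grad//.
have E : (fun s => s^-1 *: (((fun s => w (x + s *: v)) \o shift t) (s *: (1 : R)) - w (x + t *: v))) =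
  (fun s => s^-1 *: ((w \o shift (x + t *: v)) (s *: v) - w (x + t *: v))).
  apply/funext => s /=; congr (_ *: (w _ - _)).
  by rewrite [s%:A]mulr1 scalerDl addrCA.
have dv := @diff_derivable _ _ _ w _ v dw.
apply: DeriveDef.
  by rewrite /derivable E.
by rewrite /derive E.
Qed.

(** Along the ray [w exp (m t)] has zero derivative, and it vanishes at the exit
    point. *)
Lemma transport_ray_eq0 Omega w x theta (m T : R) :
  {within closure Omega, continuous w} ->
  (forall y, Omega y -> differentiable w y) ->
  0 < T -> (forall t, 0 <= t < T -> Omega (x + t *: theta)) ->
  closure Omega (x + T *: theta) -> w (x + T *: theta) = 0 ->
  (forall t, 0 < t < T ->
    dot theta (grad w (x + t *: theta)) + m * w (x + t *: theta) = 0) ->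
  w x = 0.
Proof.
move=> cw dw T0 inO clT wT eqn.
pose f t : R := w (x + t *: theta) * expR (m * t).
have clO t : t \in `[0, T] -> closure Omega (x + t *: theta).
  rewrite in_itv /= => /andP[t0]; rewrite le_eqVlt => /predU1P[->//|tT].
  by apply: subset_closure; apply: inO; rewrite t0.
have cline : continuous (fun t : R => x + t *: theta).
  move=> t; apply: cvgD; first exact: cvg_cst.
  by apply: cvgZr_tmp; exact: cvg_id.
have cf : {within `[0, T], continuous f}.
  apply/subspace_continuousP => t tI; apply: cvgM.
    move/subspace_continuousP : cw => /(_ _ (clO t tI)) cw.
    apply: cvg_comp cw => B nB.
    have H : \forall s \near t, closure Omega (x + s *: theta) -> B (x + s *: theta).
      exact: (cline t _ nB).
    have : \forall s \near t, s \in `[0, T] -> B (x + s *: theta).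
      by near=> s => sI; apply: (near H s) => //; exact: clO.
    exact.
  apply: cvg_within_filter.
  by apply: (cvg_comp (fun s => m * s) expR);
    [exact: mulrl_continuous|exact: continuous_expR].
have df t : t \in `]0, T[%R -> is_derive t (1 : R) f 0.
  rewrite in_itv /= => tI.
  have dl := is_derive_line (v := theta) (dw _ (inO t _)).
  have {}dl : is_derive t (1 : R) (fun s => w (x + s *: theta))
      (dot theta (grad w (x + t *: theta))).
    by apply: dl; case/andP: tI => /ltW -> ->.
  have de : is_derive t (1 : R) (fun s : R => expR (m * s)) (m * expR (m * t)).
    have dm : is_derive t (1 : R) (fun s : R => m * s) m.
      have -> : (fun s : R => m * s) = m *: id by [].
      by apply: is_derive_eq; rewrite /GRing.scale /= mulr1.
    by have := @is_derive1_comp _ _ _ _ _ _ (is_derive_expR (m * t)) dm; rewrite mulrC.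
  have := @is_deriveM _ _ _ _ _ _ _ _ dl de.
  move/is_derive_eq; apply.
  have /eqP := eqn t tI; rewrite addr_eq0 => /eqP ->.
  by rewrite /GRing.scale /=; ring.
have [c _] := MVT T0 df cf.
rewrite mul0r /f wT mul0r sub0r => /eqP.
by rewrite oppr_eq0 mulr0 expR0 mulr1 scale0r addr0 => /eqP.
Unshelve. all: by end_near. Qed.


Lemma plane_compact S : closed S -> bounded_set S -> compact S.
Proof.
move=> cS [M0 [_ SM]]; pose M : R := `|M0| + 1.
have {}SM x : S x -> `|x| <= M.
  by move=> Sx; apply: SM => //; rewrite /M ltr_pwDr// ler_norm.
apply: (@subclosed_compact _ S (`[(- M), M] `*` `[(- M), M])) => //.
  by apply: compact_setX; exact: segment_compact.
move=> x /SM; rewrite prod_normE ge_max => /andP[].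
by rewrite !ler_norml => ? ?; split; rewrite /= in_itv.
Qed.

Lemma between_combination x v (a b : R) : a + b != 0 ->
  x = (b / (a + b)) *: (x + a *: v) + (1 - b / (a + b)) *: (x - b *: v).
Proof.
by case: x v => [x1 x2] [v1 v2] ab; congr pair; rewrite /= /GRing.scale /=; field.
Qed.

(** The points from which the ray of direction [theta] meets [S] within time
    [M]; writing this set as an image of [S * [0, M]] makes it compact. *)
Definition shadow S theta (M : R) : set (R * R) :=
  (fun z : (R * R) * R => z.1 - z.2 *: theta) @` (S `*` `[0, M]).

Lemma closed_shadow S theta M : compact S -> closed (shadow S theta M).
Proof.
move=> cS; apply: compact_closed.
  exact: norm_hausdorff.
apply: continuous_compact; last by apply: compact_setX => //; exact: segment_compact.
apply: continuous_subspaceT => z; apply: cvgB; first exact: cvg_fst.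
by apply: cvgZr_tmp; exact: cvg_snd.
Qed.

(** Off the shadow the forward ray runs through source-free points up to the
    boundary, where [w] is zero because the exit is transversal. *)
Lemma shadow_eq0 Omega S w x theta (alpha m M : R) :
  open Omega -> bounded_set Omega -> strictly_convex Omega ->
  C2_holder_boundary alpha Omega -> circle theta ->
  {within closure Omega, continuous w} ->
  (forall y, Omega y -> differentiable w y) ->
  (forall y, Omega y -> ~ S y -> dot theta (grad w y) + m * w y = 0) ->
  (forall zeta eta, boundary Omega zeta -> outer_normal Omega zeta eta ->
     0 < dot eta theta -> w zeta = 0) ->
  (forall y (t : R), 0 <= t -> Omega y -> Omega (y + t *: theta) -> t <= M) ->
  Omega x -> ~ shadow S theta M x -> w x = 0.
Proof.
move=> oO bO cO rO cth cw dw eqn w0 OM Ox nKx.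
have [T [T0 inO nOT clT]] := exit_point oO bO cO Ox cth.
have [bT [eta on ez]] := exit_transversal oO cO rO Ox clT nOT.
apply: (transport_ray_eq0 (m := m) cw dw T0 inO clT).
  apply: (w0 _ _ bT on); move: ez.
  by rewrite addrAC subrr add0r dotC dotZl dotC pmulr_rgt0.
move=> t /andP[t0 tT]; have Ot : Omega (x + t *: theta) by apply: inO; rewrite ltW.
apply: eqn => // St; apply: nKx; exists (x + t *: theta, t); last by rewrite /= addrK.
by split=> //=; rewrite in_itv /= ltW//=; apply: (OM x) => //; exact: ltW.
Qed.

(** If [w] vanishes on both the inflow and the outflow boundary, then it vanishes
    wherever either the forward or the backward ray misses [S] (the backward one
    solves the equation for [- theta] and [- m]). What remains lies between two
    points of [S], hence inside the convex domain. *)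
Lemma transport_compact_support Omega S w theta (alpha m : R) :
  open Omega -> bounded_set Omega -> strictly_convex Omega ->
  C2_holder_boundary alpha Omega -> circle theta ->
  {within closure Omega, continuous w} ->
  (forall y, Omega y -> differentiable w y) ->
  closed S -> S `<=` Omega ->
  (forall y, Omega y -> ~ S y -> dot theta (grad w y) + m * w y = 0) ->
  (forall zeta, outflow Omega (zeta, theta) -> w zeta = 0) ->
  (forall zeta, inflow Omega (zeta, theta) -> w zeta = 0) ->
  exists K, [/\ closed K, K `<=` Omega & forall x, Omega x -> ~ K x -> w x = 0].
Proof.
move=> oO bO cO rO cth cw dw cS SO eqn wout win.
have cmpS : compact S.
  by apply: plane_compact => //; case: bO => M [Mr H]; exists M; split => // y /H {}H x /SO /H.
have cthN : circle (- theta) by move: cth; rewrite /circle /dot /= !mulrNN.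
have [M _ OM] := bounded_ray bO.
exists (shadow S theta M `&` shadow S (- theta) M); split.
- by apply: closedI; exact: closed_shadow.
- move=> x [[[s a] [/= Ss /andP[a0 _]] sx] [[s' b] [/= Ss' /andP[b0 _]] sx']].
  rewrite /= in sx sx'.
  rewrite bnd_simp in a0; rewrite bnd_simp in b0.
  have [ab0|ab] := eqVneq (a + b) 0.
    have a00 : a = 0 by lra.
    by move: sx; rewrite a00 scale0r subr0 => <-; exact: SO.
  have ab_gt0 : 0 < a + b by rewrite lt_def ab addr_ge0.
  have -> : x = (b / (a + b)) *: s + (1 - b / (a + b)) *: s'.
    have -> : s = x + a *: theta by rewrite -sx subrK.
    have -> : s' = x - b *: theta by rewrite -sx' scalerN opprK addrK.
    exact: between_combination.
  apply: strictly_convex_convex => //; [exact: SO|exact: SO|].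
  rewrite ler_pdivrMr// mul1r lerDr a0 andbT.
  by rewrite divr_ge0// ltW.
- move=> x Ox nK.
  have [K1|K1] := pselect (shadow S theta M x); last first.
    apply: (@shadow_eq0 Omega S w x theta alpha m M) => //.
      by move=> zeta eta bz on e0; apply: wout; split => //; exists eta.
    by move=> y t t0; exact: OM.
  apply: (@shadow_eq0 Omega S w x (- theta) alpha (- m) M) => //.
  + move=> y Oy nSy; have := eqn y Oy nSy; rewrite /dot /=; lra.
  + move=> zeta eta bz on e0; apply: win; split => //; exists eta => //.
    by move: e0; rewrite dotNr oppr_gt0.
  + by move=> y t t0; exact: OM.
  + by move=> K2; apply: nK.
Qed.

End Transport.

(** * Exponential weights in the transport equation *)

Section WeightedIntegral.
Context {R : realType}.
Implicit Types (x y v theta xi : R * R) (Omega K : set (R * R)).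
Implicit Types (w f : R * R -> R).
Local Notation plane := (measurableTypeR R * measurableTypeR R)%type.
Local Notation mu := (@leb2 R).
Local Notation e1 := ((1, 0) : R * R).
Local Notation e2 := ((0, 1) : R * R).

Lemma is_derive_along f x v (l : R) :
  is_derive (0 : R) (1 : R) (fun s => f (x + s *: v)) l -> is_derive x v f l.
Proof.
have E : (fun s => s^-1 *: ((f \o shift x) (s *: v) - f x)) =
  (fun s => s^-1 *: (((fun s => f (x + s *: v)) \o shift 0) (s *: (1 : R)) - f (x + 0 *: v))).
  apply/funext => s /=; congr (_ *: (f _ - f _)); last by rewrite scale0r addr0.
  by rewrite [s%:A]mulr1 addr0 addrC.
move=> [d <-]; apply: DeriveDef; first by rewrite /derivable E.
by rewrite /derive E.
Qed.

Lemma is_derive_expR_dot x v xi :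
  is_derive x v (fun y => expR (dot xi y)) (dot xi v * expR (dot xi x)).
Proof.
apply: is_derive_along.
have dm : is_derive (0 : R) (1 : R) (fun s : R => dot xi (x + s *: v)) (dot xi v).
  have -> : (fun s : R => dot xi (x + s *: v)) = dot xi v *: id + cst (dot xi x).
    by apply/funext => s; rewrite !fctE /dot /= /GRing.scale /=; ring.
  by apply: is_derive_eq; rewrite /GRing.scale /= mulr1 addr0.
have := @is_derive1_comp _ _ _ _ _ _ (is_derive_expR _) dm.
by rewrite scale0r addr0 mulrC.
Qed.

Lemma continuous_dot xi : continuous (dot xi).
Proof.
move=> x; apply: cvgD; apply: cvgM; [exact: cvg_cst|exact: cvg_fst|
  exact: cvg_cst|exact: cvg_snd].
Qed.

Lemma continuous_expR_dot xi : continuous (fun y => expR (dot xi y)).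
Proof.
move=> x; apply: (cvg_comp (dot xi) expR); first exact: continuous_dot.
exact: continuous_expR.
Qed.

(** Extend [w] by zero: since it vanishes off the closed set [K] inside the
    domain, the extension is C1 on the whole plane. With [h = w exp (dot xi x)],
    the integrand is the derivative of [h] in the direction [theta], and the
    integral of each partial derivative of [h] is zero. *)
Lemma zero_integral_transport_weight Omega K w theta xi :
  open Omega -> bounded_set Omega -> closed K -> K `<=` Omega ->
  (forall x, Omega x -> differentiable w x) ->
  {within Omega, continuous (grad w)} ->
  (forall x, Omega x -> ~ K x -> w x = 0) ->
  zero_integral mu ((fun x => (dot theta (grad w x) + dot theta xi * w x) *
    expR (dot xi x)) \_ Omega).
Proof.
move=> oO bO cK KO dw cgw w0.
pose psi x := expR (dot xi x).
pose h x := (w \_ Omega) x * psi x.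
have wO x : Omega x -> (w \_ Omega) x = w x by move=> Ox; rewrite patchE mem_set.
have nearO x : Omega x -> \forall y \near x, Omega y.
  by move=> Ox; exact: open_nbhs_nbhs.
have hK x : ~ K x -> h x = 0.
  move=> nK; rewrite /h patchE; case: ifPn => [/set_mem Ox|_]; last by rewrite mul0r.
  by rewrite w0 ?mul0r.
have nearK x : ~ K x -> \forall y \near x, ~ K y.
  by move=> nK; apply: open_nbhs_nbhs; split => //; exact: closed_openC.
have hO x v : Omega x -> is_derive x v h ((dot v (grad w x) + dot v xi * w x) * psi x).
  move=> Ox; apply: (@near_eq_is_derive _ _ _ (w * psi)).
    by apply: filterS (nearO x Ox) => y Oy; rewrite /h wO.
  have dwx : is_derive x v w (dot v (grad w x)).
    rewrite dot_grad; last exact: dw.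
    by apply/derivableP/diff_derivable/dw.
  have := @is_deriveM _ _ _ _ _ _ _ _ dwx (is_derive_expR_dot x v xi).
  move/is_derive_eq; apply.
  by rewrite /GRing.scale /= (dotC v xi) /psi; ring.
have hnO x v : ~ K x -> is_derive x v h 0.
  move=> nK; apply: (@near_eq_is_derive _ _ _ (cst (0 : R))).
    by apply: filterS (nearK x nK) => y /hK.
have der x v : derivable h x v.
  have [/KO Ox|nK] := pselect (K x); first by case: (hO x v Ox).
  by case: (hnO x v nK).
have DO x v : Omega x -> 'D_v h x = (dot v (grad w x) + dot v xi * w x) * psi x.
  by move=> Ox; have [_ <-] := hO x v Ox.
have DnK x v : ~ K x -> 'D_v h x = 0.
  by move=> nK; have [_ <-] := hnO x v nK.
have cont v : continuous ('D_v h).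
  move=> x; have [/KO Ox|nK] := pselect (K x); last first.
    rewrite /continuous_at DnK//; apply: cvg_near_cst.
    by apply: filterS (nearK x nK) => y nKy; rewrite DnK.
  rewrite /continuous_at DO//.
  have : (dot v (grad w y) + dot v xi * w y) * psi y @[y --> x] -->
         (dot v (grad w x) + dot v xi * w x) * psi x.
    apply: cvgM; last exact: continuous_expR_dot.
    apply: cvgD.
      have cg : {for x, continuous (grad w)}.
        move: cgw; rewrite (continuous_open_subspace _ oO); apply.
        exact: mem_set.
      by apply: (cvg_comp (grad w) (dot v)); [exact: cg|exact: continuous_dot].
    apply: cvgM; first exact: cvg_cst.
    by apply: differentiable_continuous; exact: dw.
  apply: cvg_trans; apply: near_eq_cvg.
  by apply: filterS (nearO x Ox) => y Oy; rewrite DO.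
have [M _ OM] : exists2 M : R, True & forall x, Omega x -> `|x| <= M.
  case: bO => M0 [_ OM]; exists (`|M0| + 1) => // x Ox.
  by apply: OM => //; rewrite ltr_pwDr// ler_norm.
have supp x : M < `|x| -> h x = 0.
  by move=> Mx; apply: hK => /KO /OM; rewrite leNgt Mx.
have i1 := integrable_partial supp (cont e1).
have i2 := integrable_partial supp (cont e2).
have I1 := integral_partial1_eq0 der supp (cont e1).
have I2 := integral_partial2_eq0 der supp (cont e2).
have -> : (fun x => (dot theta (grad w x) + dot theta xi * w x) *
      expR (dot xi x)) \_ Omega =
    (fun x => theta.1 * 'D_e1 h x + theta.2 * 'D_e2 h x).
  apply/funext => x; rewrite patchE; case: ifPn => [/set_mem Ox|].
    by rewrite !DO// /psi /dot /=; ring.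
  by rewrite notin_setE => nO; rewrite !DnK ?mulr0 ?addr0// => /KO.
exact: (zero_integralD (zero_integralZ theta.1 (conj i1 I1))
  (zero_integralZ theta.2 (conj i2 I2))).
Qed.

End WeightedIntegral.

(** * Trace-free tensors *)

Section Uniqueness.
Context {R : realType}.
Implicit Types (x y v theta xi : R * R) (Omega : set (R * R)).
Implicit Types (F : R * R -> 'M[R]_2) (u : R * R -> R * R -> R).
Local Notation plane := (measurableTypeR R * measurableTypeR R)%type.
Local Notation mu := (@leb2 R).

(** A line at distance [m / |xi|] from the origin cuts the unit circle in
    two points [p], [q], symmetric about the direction of [xi]. The determinant
    is [sin] of twice the angle between [p] and [q], up to sign, that is
    [2 (p . q) (p x q)]. Here [p x q] is nonzero since the line is a proper
    secant, and [p . q = (2 m^2 - |xi|^2) / |xi|^2] is nonzero as soon as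
    [|xi|^2 > 2 m^2]. *)
Lemma two_directions xi (m : R) : 0 < m -> 2 * m ^+ 2 < dot xi xi ->
  exists p q, [/\ circle p, circle q, dot p xi = m, dot q xi = m &
    (p.1 ^+ 2 - p.2 ^+ 2) * (2 * q.1 * q.2) -
    (q.1 ^+ 2 - q.2 ^+ 2) * (2 * p.1 * p.2) != 0].
Proof.
move=> m0 mxi; set N := dot xi xi in mxi *.
have mm : 0 < m ^+ 2 by rewrite exprn_gt0.
have N0 : 0 < N by lra.
have Nn0 : N != 0 by rewrite gt_eqF.
have km : 0 < N - m ^+ 2 by lra.
pose k := Num.sqrt (N - m ^+ 2).
have k0 : 0 < k by rewrite sqrtr_gt0.
have k2 : k ^+ 2 = N - m ^+ 2 by rewrite sqr_sqrtr// ltW.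
have EN : xi.1 * xi.1 + xi.2 * xi.2 = N by [].
have key (s : R) : s ^+ 2 = k ^+ 2 ->
    circle (N^-1 *: (m *: xi + s *: perp xi)) /\
    dot (N^-1 *: (m *: xi + s *: perp xi)) xi = m.
  move=> s2; split.
    rewrite /circle /= /dot /perp /= /GRing.scale /=.
    transitivity (N^-1 ^+ 2 * ((m ^+ 2 + s ^+ 2) * (xi.1 * xi.1 + xi.2 * xi.2))).
      by ring.
    by rewrite s2 k2 EN; field.
  rewrite /dot /perp /= /GRing.scale /=.
  transitivity (N^-1 * (m * (xi.1 * xi.1 + xi.2 * xi.2))); first by ring.
  by rewrite EN; field.
(* the secant points are (m xi + s perp xi) / |xi|^2 for s = k and s = - k *)
have [cp pm] := key k erefl.
have [cq qm] := key (- k) (sqrrN k).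
exists (N^-1 *: (m *: xi + k *: perp xi)), (N^-1 *: (m *: xi + (- k) *: perp xi)).
split=> //.
have -> : forall p q : R * R, (p.1 ^+ 2 - p.2 ^+ 2) * (2 * q.1 * q.2) -
    (q.1 ^+ 2 - q.2 ^+ 2) * (2 * p.1 * p.2) =
    2 * dot p q * (p.1 * q.2 - p.2 * q.1) by move=> p q; rewrite /dot; ring.
rewrite /dot /perp /= /GRing.scale /=.
rewrite (_ : _ * _ * _ = N^-1 ^+ 4 * (- 4) * m * k * (m ^+ 2 - k ^+ 2) *
   (xi.1 * xi.1 + xi.2 * xi.2) ^+ 2); last by ring.
rewrite EN k2 !mulf_neq0 ?expf_neq0 ?invr_eq0 ?oppr_eq0 ?pnatr_eq0 ?(gt_eqF m0) ?(gt_eqF k0)//.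
by rewrite lt_eqF//; lra.
Qed.

Lemma ae_in_and (A B : set (R * R)) (P Q : R * R -> Prop) :
  ae_in A P -> ae_in B Q -> ae_in (A `&` B) (fun x => P x /\ Q x).
Proof.
apply: (@filterS2 _ _ (ae_filter_ringOfSetsType mu)) => x hP hQ.
by move=> [/hP ? /hQ ?].
Qed.

Lemma closed_ess_support F : closed (ess_support F).
Proof.
rewrite -[ess_support F]setCK; apply: open_closedC; rewrite openE => x.
move=> /= /contrapT[U [[oU Ux] UF]].
apply: (@filterS _ _ _ U); last exact: open_nbhs_nbhs.
by move=> y Uy; apply; exists U.
Qed.

(** In terms of the angle of [theta]: [f11 cos (2 phi) + f12 sin (2 phi)] on the
    unit circle. *)
Lemma quadratic_form_tracefree (A : 'M[R]_2) theta : A^T = A -> A 0 0 + A 1 1 = 0 ->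
  dot (mulmxp A theta) theta =
  A 0 0 * (theta.1 ^+ 2 - theta.2 ^+ 2) + A 0 1 * (2 * theta.1 * theta.2).
Proof.
move=> AT A0.
have A11 : A 1 1 = - A 0 0 by apply/eqP; rewrite -addr_eq0 addrC A0.
have A10 : A 1 0 = A 0 1 by rewrite -[in LHS]AT mxE.
by rewrite /dot /mulmxp /= A11 A10; ring.
Qed.

Lemma tracefree_symmetric_eq (A B : 'M[R]_2) : A^T = A -> B^T = B ->
  A 0 0 + A 1 1 = 0 -> B 0 0 + B 1 1 = 0 -> A 0 0 = B 0 0 -> A 0 1 = B 0 1 ->
  A = B.
Proof.
move=> AT BT A0 B0 AB0 AB1; have AB10 : A 1 0 = B 1 0.
  by rewrite -[in LHS]AT -[in RHS]BT !mxE.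
have AB11 : A 1 1 = B 1 1.
  by apply: (addrI (A 0 0)); rewrite A0 AB0 B0.
have I2 (i : 'I_2) : i = 0 \/ i = 1.
  by case: i => [[|[|//]] ?]; [left|right]; apply: val_inj.
by apply/matrixP => i j; case: (I2 i) => ->; case: (I2 j) => ->.
Qed.

Lemma dot_gradB (f g : R * R -> R) theta x : differentiable f x -> differentiable g x ->
  dot theta (grad (f - g) x) = dot theta (grad f x) - dot theta (grad g x).
Proof.
move=> df dg; rewrite !dot_grad//; last exact: differentiableB.
by rewrite deriveB//; exact: diff_derivable.
Qed.


(** Each direction [theta] with [dot theta xi = m] yields one linear relation
    between the Laplace transforms at [xi] of the two components of the
    difference of the tensors. *)
Lemma zero_integral_tracefree_weight Omega (alpha m p : R) F F' u u' theta xi :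
  domain Omega -> bounded_set Omega -> strictly_convex Omega ->
  C2_holder_boundary alpha Omega ->
  tensor_class Omega p F -> tensor_class Omega p F' ->
  transport_solution Omega m F u -> transport_solution Omega m F' u' ->
  (forall x v, outflow Omega (x, v) -> u x v = u' x v) ->
  circle theta -> dot theta xi = m ->
  zero_integral mu ((fun x =>
    ((F x 0 0 - F' x 0 0) * (theta.1 ^+ 2 - theta.2 ^+ 2) +
     (F x 0 1 - F' x 0 1) * (2 * theta.1 * theta.2)) * expR (dot xi x)) \_ Omega).
Proof.
move=> [oO _ _] bO cO rO [sobF symF suppF trF] [sobF' symF' suppF' trF'].
move=> [sol infl] [sol' infl'] data cth thxi.
have [cu du cgu equ] := sol theta cth.
have [cu' du' cgu' equ'] := sol' theta cth.
pose w : R * R -> R := (u^~ theta) - (u'^~ theta).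
have gradw x : Omega x -> dot theta (grad w x) =
    dot theta (grad (u^~ theta) x) - dot theta (grad (u'^~ theta) x).
  by move=> Ox; apply: dot_gradB; [exact: du|exact: du'].
have cw : {within closure Omega, continuous w}.
  apply/subspace_continuousP => x clx; apply: cvgB.
  - by move/subspace_continuousP : cu; exact.
  - by move/subspace_continuousP : cu'; exact.
have dw x : Omega x -> differentiable w x.
  by move=> Ox; apply: differentiableB; [exact: du|exact: du'].
have cgw : {within Omega, continuous (grad w)}.
  move: cgu cgu'; rewrite !(continuous_open_subspace _ oO) => cgu cgu' x xO.
  have Ox := set_mem xO.
  have gE y : Omega y -> grad w y = grad (u^~ theta) y - grad (u'^~ theta) y.
    move=> Oy; congr pair; rewrite /= deriveB//; apply: diff_derivable;
      by [exact: du|exact: du'].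
  have : grad (u^~ theta) y - grad (u'^~ theta) y @[y --> x] -->
         grad (u^~ theta) x - grad (u'^~ theta) x.
    by apply: cvgB; [exact: cgu|exact: cgu'].
  rewrite /prop_for /continuous_at gE//; apply: cvg_trans; apply: near_eq_cvg.
  by apply: filterS (open_nbhs_nbhs (conj oO Ox)) => y Oy; rewrite gE.
pose S := ess_support F `|` ess_support F'.
pose E x := dot theta (grad w x) + m * w x.
have EE x : Omega x -> E x =
    (dot theta (grad (u^~ theta) x) + m * u x theta) -
    (dot theta (grad (u'^~ theta) x) + m * u' x theta).
  by move=> Ox; rewrite /E gradw// /w !fctE; ring.
have cE x : Omega x -> {for x, continuous E}.
  move=> Ox; apply: cvgD.
    apply: (cvg_comp (grad w) (dot theta)); last exact: continuous_dot.
    by move: cgw; rewrite (continuous_open_subspace _ oO); apply; exact: mem_set.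
  apply: cvgM; first exact: cvg_cst.
  by apply: differentiable_continuous; exact: dw.
(* the equation holds almost everywhere, but its left-hand side is continuous,
   so off the supports it vanishes at every point *)
have E0 x : Omega x -> ~ S x -> E x = 0.
  move=> Ox nS; apply: contrapT => Ex.
  have [U [[oU Ux] UF]] : exists U, open_nbhs x U /\ ae_in U (fun y => F y = 0).
    by apply: contrapT => nU; apply: nS; left.
  have [U' [[oU' U'x] UF']] : exists U, open_nbhs x U /\ ae_in U (fun y => F' y = 0).
    by apply: contrapT => nU; apply: nS; right.
  have nE : \forall y \near x, E y != 0.
    have /cvgr_neq0 := cE x Ox.
    by apply; apply/eqP.
  have nV : \forall y \near x, [/\ Omega y, U y, U' y & E y != 0].
    have nO : \forall y \near x, Omega y by exact: open_nbhs_nbhs.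
    have nU : \forall y \near x, U y by exact: open_nbhs_nbhs.
    have nU' : \forall y \near x, U' y by exact: open_nbhs_nbhs.
    near=> y; split.
    - exact: (near nO y).
    - exact: (near nU y).
    - exact: (near nU' y).
    - exact: (near nE y).
  have [z Vz Ez] : exists2 z, interior [set y | [/\ Omega y, U y, U' y & E y != 0]] z &
      E z = 0.
    apply: ae_in_open_exists; [exact: open_interior|by exists x|].
    have H := ae_in_and (ae_in_and equ equ') (ae_in_and UF UF').
    apply: (@filterS _ _ (ae_filter_ringOfSetsType mu)) H => z /= H.
    move=> /interior_subset [Oz Uz U'z _].
    have [[ez ez'] [Fz F'z]] := H (conj (conj Oz Oz) (conj Uz U'z)).
    by rewrite EE// ez ez' Fz F'z subrr.
  by have [_ _ _ /eqP] := interior_subset Vz.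
have bdry zeta : outflow Omega (zeta, theta) -> w zeta = 0.
  by move=> /data; rewrite /w !fctE => ->; rewrite subrr.
have bdry' zeta : inflow Omega (zeta, theta) -> w zeta = 0.
  by move=> iz; rewrite /w !fctE infl// infl'// subrr.
have [K [cK KO K0]] := @transport_compact_support R Omega S w theta alpha m
  oO bO cO rO cth cw dw (closedU (@closed_ess_support F) (@closed_ess_support F'))
  (fun x => or_ind (@suppF x) (@suppF' x)) E0 bdry bdry'.
have := zero_integral_transport_weight theta xi oO bO cK KO dw cgw K0.
have mO := measurable_open_plane oO.
have mF i j : @measurable_fun _ _ plane (measurableTypeR R) Omega (fun x => F x i j).
  by have [[]] := sobF i j.
have mF' i j : @measurable_fun _ _ plane (measurableTypeR R) Omega (fun x => F' x i j).
  by have [[]] := sobF' i j.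
apply: zero_integral_ae.
  apply/measurable_restrict => //; rewrite setTI.
  apply: measurable_funM; last first.
    by apply: measurable_fun_open_continuous => // x _; exact: continuous_expR_dot.
  by apply: measurable_funD; (apply: measurable_funM;
    [by apply: measurable_funB; [exact: mF|exact: mF']|exact: measurable_cst]).
have H := ae_in_and (ae_in_and equ equ')
  (ae_in_and (ae_in_and symF trF) (ae_in_and symF' trF')).
apply: (@filterS _ _ (ae_filter_ringOfSetsType mu)) H => x /= H.
rewrite !patchE; case: ifPn => // /set_mem Ox.
have OO := conj Ox Ox.
have [[ex ex'] [[sx tx] [sx' tx']]] := H (conj OO (conj OO OO)).
congr (_ * _); rewrite thxi -/(E x) EE// ex ex'.
rewrite (quadratic_form_tracefree _ sx tx).
by rewrite (quadratic_form_tracefree _ sx' tx'); ring.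
Unshelve. all: by end_near. Qed.

End Uniqueness.

Unset Implicit Arguments.

(** * Uniqueness theorem *)

Theorem theorem3p2 (R : realType) (Omega : set (R * R)) (alpha mu p : R)
    (F F' : R * R -> 'M[R]_2) (u u' : R * R -> R * R -> R)
    (Omega_domain : domain Omega)
    (Omega_bounded : bounded_set Omega)
    (Omega_strictly_convex : strictly_convex Omega)
    (alpha_gt : 1 / 2 < alpha)
    (Omega_C2alpha : C2_holder_boundary alpha Omega)
    (mu_gt0 : 0 < mu)
    (p_gt4 : 4 < p)
    (F_class : tensor_class Omega p F)
    (F'_class : tensor_class Omega p F')
    (u_sol : transport_solution Omega mu F u)
    (u'_sol : transport_solution Omega mu F' u')
    (same_data : forall x theta : R * R,
       outflow Omega (x, theta) -> u x theta = u' x theta) :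
  ae_in Omega (fun x => F x = F' x).
Proof.
pose g1 x := F x 0 0 - F' x 0 0; pose g2 x := F x 0 1 - F' x 0 1.
(* every xi0 + (m, n) has squared length at least (2 mu)^2 > 2 mu^2 *)
pose xi0 : R * R := (2 * mu, 0).
have laplace (m n : nat) :
    zero_integral (@leb2 R)
      ((fun x => g1 x * expR (dot (xi0 + (m%:R, n%:R)) x)) \_ Omega) /\
    zero_integral (@leb2 R)
      ((fun x => g2 x * expR (dot (xi0 + (m%:R, n%:R)) x)) \_ Omega).
  set xi := xi0 + _.
  have [|th [th' [cth cth' thxi th'xi D0]]] := @two_directions R xi mu mu_gt0.
    have m0 : (0 : R) <= m%:R by [].
    have n0 : (0 : R) <= n%:R by [].
    by rewrite /xi /dot /=; nra.
  apply: (zero_integral_solve2 D0);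
    exact: (zero_integral_tracefree_weight Omega_domain Omega_bounded
      Omega_strictly_convex Omega_C2alpha F_class F'_class u_sol u'_sol same_data).
have g1_0 := laplace_eq0 Omega_bounded (fun m n => (laplace m n).1).
have g2_0 := laplace_eq0 Omega_bounded (fun m n => (laplace m n).2).
have [_ symF _ trF] := F_class; have [_ symF' _ trF'] := F'_class.
have H := ae_in_and (ae_in_and g1_0 g2_0)
  (ae_in_and (ae_in_and symF trF) (ae_in_and symF' trF')).
apply: (@filterS _ _ (ae_filter_ringOfSetsType (@leb2 R))) H => x /= H Ox.
have OO := conj Ox Ox.
have [[g1x g2x] [[sx tx] [sx' tx']]] := H (conj OO (conj OO OO)).
by apply: tracefree_symmetric_eq => //; apply/subr0_eq.
Qed.
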